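(* Let $A\in\mathbb{R}^{n\times n}$ have distinct eigenvalues $\lambda_1,\dots,\lambda_p$ with geometric multiplicities $k_1,\dots,k_p$, and let $\bar B\in\{0,\ast\}^{n\times l}$ be a sparsity pattern. The following statements are equivalent: (a) there exists a real matrix $B$ with sparsity pattern $\bar B$ (i.e. $B\in\mathbb{R}^{n\times l}$ with $B_{ij}=0$ whenever $\bar B_{ij}=0$) such that $(A,B)$ is controllable; (b) for each $i$, $1\le i\le p$, there exists a $k_i\times k_i$ submatrix of $\bar B$ whose generic rank is $k_i$ and whose row index set belongs to $H_i$; (c) for each $i$, $1\le i\le p$, in the input-state-mode digraph $\mathcal{G}(A,\bar B)$ associated with a collection of left eigenbases $X_1,\dots,X_p$ of $A$, there exist $k_i$ disjoint $\mathcal{U}$-$\mathcal{V}_s$-$m_i$ paths (this collection of paths being denoted $\mathcal{P}_i$) such that $V(\mathcal{P}_i)\cap\mathcal{V}_s\in H_i$.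
   Context: $(A,B)$ controllable refers to the system $\dot x(t)=Ax(t)+Bu(t)$. For each eigenvalue $\lambda_i$ (possibly complex), $k_i=n-\mathrm{rank}(\lambda_iI-A)$, and $X_i\in\mathbb{C}^{n\times k_i}$ is a left eigenbasis associated with $\lambda_i$: its columns are linearly independent vectors spanning the left null space of $\lambda_iI-A$, i.e. $X_i^{\intercal}(\lambda_i I-A)=0$. For $\mathcal{J}\subseteq\{1,\dots,n\}$, $X_{i\mathcal{J}}^{\intercal}$ denotes the submatrix of $X_i^{\intercal}$ formed by the columns indexed by $\mathcal{J}$. Define $$H_i=\{\mathcal{J}\subseteq\{1,\dots,n\}:\ |\mathcal{J}|=k_i,\ X_{i\mathcal{J}}^{\intercal}\text{ has full row rank}\};$$ this does not depend on the choice of $X_i$. A structured matrix $\bar M\in\{0,\ast\}^{m\times r}$ has entries that are either fixed zeros or free parameters ($\ast$); its generic rank is the maximum rank it can achieve as a function of its free parameters. The input-state-mode (ISM) digraph $\mathcal{G}(A,\bar B)$ associated with $X_1,\dots,X_p$ has vertex set $\mathcal{U}\cup\mathcal{V}_s\cup\mathcal{V}_m$, where $\mathcal{U}=\{u_1,\dots,u_l\}$ (inputs), $\mathcal{V}_s=\{1,\dots,n\}$ (states), and $\mathcal{V}_m=\bigcup_{i=1}^p m_i$ with $m_i=\{m_{i1},\dots,m_{ik_i}\}$ (modes associated with $\lambda_i$). Its directed edges are $(u_i,j)$ for all $i,j$ with $\bar B_{ji}\neq0$, and $(i,m_{jk})$ for all $i\in\mathcal{V}_s$ and $m_{jk}\in\mathcal{V}_m$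 with $(X_j^{\intercal})_{ki}\ne0$. A $\mathcal{U}$-$\mathcal{V}_s$-$m_i$ path is a path $u\to s\to m$ with $u\in\mathcal{U}$, $s\in\mathcal{V}_s$, $m\in m_i$; disjoint means sharing no vertices. $V(\mathcal{P}_i)$ is the set of vertices on the paths of $\mathcal{P}_i$. *)

(* Defs.v *)
From HB Require Import structures.
From mathcomp Require Import all_boot all_order all_algebra.
From mathcomp Require Import all_classical all_reals all_analysis.
From mathcomp Require Import complex.

Set Implicit Arguments.
Unset Strict Implicit.
Unset Printing Implicit Defensive.

Import Order.TTheory GRing.Theory Num.Theory.
Import numFieldNormedType.Exports.

Local Open Scope classical_set_scope.
Local Open Scope ring_scope.

Section Controllability.
Variables (R : realType) (n l : nat).

(* Topological notions are taken coordinatewise, which makes sense for n = 0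
   and l = 0 too. The derivative is two-sided, hence only required in the open
   interval; continuity on the closed interval pins down both end states. *)
Definition trajectory (A : 'M[R]_n) (B : 'M[R]_(n, l)) (T : R)
    (u : R -> 'cV[R]_l) (x : R -> 'cV[R]_n) : Prop :=
  [/\ forall j, {within `[0, T], continuous (fun t : R => u t j 0)},
      forall i, {within `[0, T], continuous (fun t : R => x t i 0)} &
      forall i (t : R), 0 < t < T ->
        is_derive t 1 (fun s => x s i 0) ((A *m x t + B *m u t) i 0)].

Definition controllable (A : 'M[R]_n) (B : 'M[R]_(n, l)) : Prop :=
  forall x0 x1 : 'cV[R]_n, exists (T : R) (u : R -> 'cV[R]_l)
    (x : R -> 'cV[R]_n),
    [/\ 0 < T, trajectory A B T u x, x 0 = x0 & x T = x1].

End Controllability.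

(* A structured matrix is a boolean matrix: [true] is a free parameter and
   [false] a fixed zero. A free parameter may take the value 0. *)
Definition has_pattern (F : fieldType) (m r : nat) (M : 'M[bool]_(m, r))
    (N : 'M[F]_(m, r)) : Prop :=
  forall i j, ~~ M i j -> N i j = 0.

Definition generic_rank (F : fieldType) (m r : nat) (M : 'M[bool]_(m, r)) :
    nat :=
  \max_(k < (minn m r).+1 |
        `[< exists2 N : 'M[F]_(m, r), has_pattern M N & \rank N = k >]) k.

(* The submatrix of M with row set J and column set K, in increasing order. *)
Definition submx_of (T : Type) (m r : nat) (J : {set 'I_m}) (K : {set 'I_r})
    (M : 'M[T]_(m, r)) : 'M[T]_(#|J|, #|K|) :=
  mxsub (@enum_val _ (mem J)) (@enum_val _ (mem K)) M.

Section Eigenbases.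
Variables (R : rcfType) (n : nat) (A : 'M[R]_n).

Definition complex_mx : 'M[R[i]]_n := map_mx (real_complex R) A.

Definition geo_mult (z : R[i]) : nat := (n - \rank (z%:M - complex_mx)%R)%N.

(* [kermx] is the left null space, as a row space. *)
Definition left_eigenbasis (z : R[i]) (X : 'M[R[i]]_(n, geo_mult z)) : Prop :=
  row_free X^T /\ (X^T == kermx (z%:M - complex_mx)%R)%MS.

Definition distinct_eigenvalues (p : nat) (lam : 'I_p -> R[i]) : Prop :=
  injective lam /\
  forall z, eigenvalue complex_mx z <-> exists i, lam i = z.

End Eigenbases.

Definition full_rank_sets (F : fieldType) (n k : nat) (X : 'M[F]_(n, k)) :
    {set {set 'I_n}} :=
  [set J : {set 'I_n} |
    (#|J| == k) && row_free (colsub (@enum_val _ (mem J)) X^T)].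

Section ISMDigraph.
Variables (F : fieldType) (n l p : nat) (k : 'I_p -> nat).

(* Inputs, states, and modes; the mode m_{ij} is [Tagged _ j], with tag i. *)
Definition ism_vertex : finType :=
  ('I_l + 'I_n + {i : 'I_p & 'I_(k i)})%type.

Definition input_vertex (u : 'I_l) : ism_vertex := inl (inl u).
Definition state_vertex (s : 'I_n) : ism_vertex := inl (inr s).
Definition mode_vertex (i : 'I_p) (j : 'I_(k i)) : ism_vertex :=
  inr (Tagged (fun i => 'I_(k i)) j).

Variables (X : forall i, 'M[F]_(n, k i)) (Bbar : 'M[bool]_(n, l)).

Definition ism_edge : rel ism_vertex := fun v w =>
  match v, w with
  | inl (inl u), inl (inr s) => Bbar s u
  | inl (inr s), inr m => (X (tag m))^T (tagged m) s != 0
  | _, _ => false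
  end.

Definition input_state_mode_path (i : 'I_p) (P : seq ism_vertex) : Prop :=
  exists (u : 'I_l) (s : 'I_n) (j : 'I_(k i)),
    P = [:: input_vertex u; state_vertex s; mode_vertex j] /\
    path ism_edge (input_vertex u) [:: state_vertex s; mode_vertex j].

Definition states_on (q : nat) (P : 'I_q -> seq ism_vertex) : {set 'I_n} :=
  [set s | [exists r, state_vertex s \in P r]].

End ISMDigraph.

(* Main.v *)
Require Import Defs.
From mathcomp Require Import all_boot all_order all_fingroup all_algebra.
From mathcomp Require Import all_classical all_reals all_analysis.
From mathcomp Require Import complex.
From mathcomp Require Import ring.

(** Everything is reduced to one combinatorial object.  For an eigenvalue with
    left eigenbasis X and multiplicity k, a matching ([matched]) consists of k
    states f and k distinct inputs g such that f c and g c are joined by a free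
    entry of the pattern and the columns f of X^T form an invertible matrix.

    Statements (b) and (c) say that every eigenvalue has a matching.  A nonzero
    determinant has a nonzero term in its Leibniz expansion, that is, a
    permutation along which no entry vanishes.  Applied to a full-rank
    realization of the submatrix of the pattern, this turns (b) into a matching
    ([submatrix_matched]); applied to the chosen columns of X^T, it supplies the
    state-to-mode edges of the disjoint paths of (c) ([matched_paths]).
    Conversely, disjointness makes the inputs and the states of the paths
    distinct ([paths_matched]), and the 0-1 matrix of a matching realizes the
    rank required by (b) ([matched_submatrix]).

    Statement (a) enters through the Popov-Belevitch-Hautus test:
    controllability means that no left eigenvector of A over the complex
    numbers is annihilated by B, or equivalently that X^T B has full row rank
    for every eigenbasis X ([eigenbasis_hautus]).  If X^T B has full rank, then
    one of its maximal minors is nonzero, and so is a term of the expansion of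
    that minor over the maps from its columns to the states, in the manner of
    Cauchy and Binet; this term is a matching ([full_rank_matched]).  In the
    other direction the 0-1 matrix of a matching serves a single eigenvalue, and
    a generic point of the line through two matrices of the pattern keeps every
    full rank condition that holds somewhere on that line, which yields one B
    for all eigenvalues ([common_full_rank]).

    The test itself has two halves.  Along an eigenvector v with v B = 0 the
    coordinate v x(t) obeys z' = lambda z whatever the input is, so that
    starting at 0 it remains 0 ([controllable_hautus]).  For the converse, write
    the adjugate of s - A as a polynomial in s with matrix coefficients N_k.
    Since (s - A) adj(s - A) = chi(s), every smooth phi gives a trajectory
    x = sum_k N_k B phi^(k) with input u = chi(d/dt) phi.  The Hautus condition
    makes the N_k B jointly of rank n ([resolvent_gramian_unit]), so the two
    end states of x are prescribed by prescribing the derivatives of a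
    polynomial phi at 0 and at 1, a Hermite interpolation problem
    ([two_point_hermite]).  *)

Set Implicit Arguments.
Unset Strict Implicit.
Unset Printing Implicit Defensive.

Import Order.TTheory GRing.Theory Num.Theory.
Import numFieldNormedType.Exports.

Local Open Scope ring_scope.

(** * Determinants, minors and generic ranks *)

(** The first half of the Cauchy-Binet formula: multilinearity in the columns
    of N.  The terms are not grouped by the image of f, since the purpose is to
    extract one nonzero term from a nonzero determinant. *)
Lemma det_mulmx_colsub (F : comNzRingType) (n k : nat) (Y : 'M[F]_(k, n))
    (N : 'M[F]_(n, k)) :
  \det (Y *m N) = \sum_(f : {ffun 'I_k -> 'I_n})
                    (\prod_c N (f c) c) * \det (colsub f Y).
Proof.
transitivity (\sum_(s : 'S_k) \sum_(f : {ffun 'I_k -> 'I_n})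
    (-1) ^+ s * \prod_c (Y (s c) (f c) * N (f c) c)).
  rewrite -det_tr; apply: eq_bigr => s _; rewrite -big_distrr /=; congr (_ * _).
  rewrite -(bigA_distr_bigA (fun c j => Y (s c) j * N j c)).
  by apply: eq_bigr => c _; rewrite !mxE.
rewrite exchange_big; apply: eq_bigr => f _ /=.
rewrite -[\det _]det_tr big_distrr; apply: eq_bigr => s _ /=.
rewrite big_split /= [RHS]mulrCA; congr (_ * _); rewrite mulrC; congr (_ * _).
by apply: eq_bigr => c _; rewrite !mxE.
Qed.

Lemma det_neq0_perm (F : idomainType) (k : nat) (M : 'M[F]_k) :
  \det M != 0 -> exists s : 'S_k, forall i, M i (s i) != 0.
Proof.
move=> detM.
suff /existsP [s /forallP Ms] : [exists s : 'S_k, forall i, M i (s i) != 0].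
  by exists s.
apply: contraNT detM => /existsPn noperm.
rewrite /determinant big1 // => s _.
have /forallPn [i /negPn /eqP Mi0] := noperm s.
by rewrite (bigD1 i) //= Mi0 mul0r mulr0.
Qed.

Lemma row_free_det (F : fieldType) (k : nat) (M : 'M[F]_k) :
  row_free M = (\det M != 0).
Proof. by rewrite row_free_unit unitmxE unitfE. Qed.

Lemma colsub_det_inj (F : fieldType) (n k : nat) (Y : 'M[F]_(k, n))
    (f : 'I_k -> 'I_n) : \det (colsub f Y) != 0 -> injective f.
Proof.
move=> detf a b fab; apply/eqP; apply: contraNT detf => aDb.
rewrite -det_tr (determinant_alternate aDb) // => c.
by rewrite !mxE fab.
Qed.

(** Repeating or permuting the selected rows and columns amounts to multiplying
    by selection matrices, so the rank of a submatrix depends only on the sets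
    of indices that occur. *)
Lemma rank_mxsub_le (F : fieldType) (m n a b a' b' : nat) (M : 'M[F]_(m, n))
    (f : 'I_a -> 'I_m) (g : 'I_b -> 'I_n)
    (f' : 'I_a' -> 'I_m) (g' : 'I_b' -> 'I_n) :
    (forall i, exists i', f i = f' i') -> (forall j, exists j', g j = g' j') ->
  (\rank (mxsub f g M) <= \rank (mxsub f' g' M))%N.
Proof.
move=> /choice [r fr] /choice [q gq].
have -> : mxsub f g M
    = rowsub r 1%:M *m mxsub f' g' M *m colsub q 1%:M.
  by rewrite mul_rowsub_mx mul1mx mulmx_colsub mulmx1 -!mxsub_comp;
     apply/matrixP => i j; rewrite !mxE fr gq.
by apply: leq_trans (mxrankM_maxl _ _) (mxrankM_maxr _ _).
Qed.

(** Replaces the increasing enumeration of a set of columns by an arbitrary one,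
    so that determinants of square matrices become available. *)
Lemma imset_full_rank_sets (F : fieldType) (n k : nat) (X : 'M[F]_(n, k))
    (f : 'I_k -> 'I_n) : injective f ->
  (f @: 'I_k \in full_rank_sets X) = (\det (colsub f X^T) != 0).
Proof.
move=> f_inj; rewrite inE -row_free_det; set J := f @: _.
have -> : (#|J| == k) = true by rewrite card_imset // card_ord eqxx.
rewrite /= /row_free; congr (_ == _).
have H1 c : exists i, f c = @enum_val _ (mem J) i.
  have fcJ : f c \in J by apply: imset_f.
  by exists (enum_rank_in fcJ (f c)); rewrite enum_rankK_in.
have H2 i : exists c, @enum_val _ (mem J) i = f c.
  by have /imsetP [c _ ->] := enum_valP i; exists c.
have H0 (i : 'I_k) : exists i', id i = id i' by exists i.
by apply/eqP; rewrite eqn_leq !rank_mxsub_le.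
Qed.

Lemma generic_rank_ge (F : fieldType) (m r : nat) (M : 'M[bool]_(m, r))
    (N : 'M[F]_(m, r)) : has_pattern M N -> (\rank N <= generic_rank F M)%N.
Proof.
move=> MN; have rkN : (\rank N < (minn m r).+1)%N.
  by rewrite ltnS leq_min rank_leq_row rank_leq_col.
rewrite -[X in (X <= _)%N]/(val (Ordinal rkN)); apply: leq_bigmax_cond.
by apply/asboolP; exists N.
Qed.

Lemma generic_rank_le_row (F : fieldType) (m r : nat) (M : 'M[bool]_(m, r)) :
  (generic_rank F M <= m)%N.
Proof.
apply/bigmax_leqP => k _.
by rewrite (leq_trans (_ : k <= minn m r)%N) ?geq_minl // -ltnS.
Qed.

(** The maximum is over a nonempty set of ranks, as the zero matrix has every
    pattern. *)
Lemma generic_rank_attained (F : fieldType) (m r : nat) (M : 'M[bool]_(m, r)) :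
  exists2 N : 'M[F]_(m, r), has_pattern M N & \rank N = generic_rank F M.
Proof.
have [|/= k /asboolP [N MN rkN] gE] := @eq_bigmax_cond _
    [pred k : 'I_(minn m r).+1 | `[< exists2 N : 'M[F]_(m, r),
       has_pattern M N & \rank N = k >]] (fun k => k).
  apply/card_gt0P; exists ord0; apply/asboolP.
  exists (0 : 'M[F]_(m, r)); [by move=> i j _; rewrite mxE | by rewrite mxrank0].
by exists N; rewrite // rkN /generic_rank -gE.
Qed.

(** * Matchings between inputs, states and modes *)

(** The injectivity of f is implied by the determinant ([colsub_det_inj]); the
    matching between states and modes is left implicit in the determinant. *)
Definition matched (F : fieldType) (n l k : nat) (X : 'M[F]_(n, k))
    (Bbar : 'M[bool]_(n, l)) (f : 'I_k -> 'I_n) (g : 'I_k -> 'I_l) : Prop :=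
  [/\ injective g, forall c, Bbar (f c) (g c) & \det (colsub f X^T) != 0].

Definition matching_mx (F : fieldType) (n l k : nat) (f : 'I_k -> 'I_n)
    (g : 'I_k -> 'I_l) : 'M[F]_(n, l) :=
  \matrix_(s, u) [exists c, (f c == s) && (g c == u)]%:R.

Lemma matching_mx_pattern (F : fieldType) (n l k : nat) (X : 'M[F]_(n, k))
    (Bbar : 'M[bool]_(n, l)) (f : 'I_k -> 'I_n) (g : 'I_k -> 'I_l)
    (F' : fieldType) :
  matched X Bbar f g -> has_pattern Bbar (matching_mx F' f g).
Proof.
move=> [_ Bfg _] s u; rewrite mxE; case: existsP => //= -[c].
by case/andP => /eqP <- /eqP <-; rewrite Bfg.
Qed.

Lemma colsub_matching_mx (F : fieldType) (n l k : nat) (f : 'I_k -> 'I_n)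
    (g : 'I_k -> 'I_l) : injective g ->
  colsub g (matching_mx F f g) = colsub f 1%:M.
Proof.
move=> g_inj; apply/matrixP => s c; rewrite !mxE; congr (_%:R).
have [->|sDfc] /= := eqVneq s (f c).
  by have -> : [exists c', (f c' == f c) && (g c' == g c)]
    by apply/existsP; exists c; rewrite !eqxx.
case: existsP => // -[c' /andP [/eqP fs /eqP /g_inj c'c]].
by move: sDfc; rewrite -fs c'c eqxx.
Qed.

(** The matching itself, as a 0-1 matrix, contains an identity block of size k
    in the rows f and the columns g. *)
Lemma matched_submatrix (F F' : fieldType) (n l k : nat) (X : 'M[F]_(n, k))
    (Bbar : 'M[bool]_(n, l)) (f : 'I_k -> 'I_n) (g : 'I_k -> 'I_l) :
    matched X Bbar f g ->
  exists (J : {set 'I_n}) (K : {set 'I_l}),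
    [/\ #|J| = k, #|K| = k, generic_rank F' (submx_of J K Bbar) = k &
        J \in full_rank_sets X].
Proof.
move=> fg; have [g_inj _ detf] := fg; have f_inj := colsub_det_inj detf.
have cJ : #|f @: 'I_k| = k by rewrite card_imset // card_ord.
have cK : #|g @: 'I_k| = k by rewrite card_imset // card_ord.
exists (f @: 'I_k), (g @: 'I_k); split=> //; last by rewrite imset_full_rank_sets.
apply/eqP; rewrite eqn_leq -[X in (_ <= X)%N && _]cJ generic_rank_le_row /=.
pose E := matching_mx F' f g.
apply: leq_trans (generic_rank_ge (N := submx_of (f @: 'I_k) (g @: 'I_k) E) _).
  rewrite -[X in (X <= _)%N](@mxrank1 F').
  have -> : (1%:M : 'M[F']_k) = mxsub f g E.
    have -> : mxsub f g E = rowsub f (colsub g E).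
      by apply/matrixP => i j; rewrite !mxE.
    rewrite colsub_matching_mx //; apply/matrixP => i j.
    by rewrite !mxE (inj_eq f_inj).
  apply: rank_mxsub_le => c.
    have fcJ : f c \in f @: 'I_k by apply: imset_f.
    by exists (enum_rank_in fcJ (f c)); rewrite enum_rankK_in.
  have gcJ : g c \in g @: 'I_k by apply: imset_f.
  by exists (enum_rank_in gcJ (g c)); rewrite enum_rankK_in.
by move=> i j; rewrite !mxE => /(matching_mx_pattern F' fg); rewrite mxE.
Qed.

(** A realization of full rank has a nonzero determinant, hence a permutation
    along which its entries are nonzero, and these entries are free. *)
Lemma submatrix_matched (F F' : fieldType) (n l k : nat) (X : 'M[F]_(n, k))
    (Bbar : 'M[bool]_(n, l)) (J : {set 'I_n}) (K : {set 'I_l}) :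
    #|J| = k -> #|K| = k -> generic_rank F' (submx_of J K Bbar) = k ->
    J \in full_rank_sets X ->
  exists f g, matched X Bbar f g.
Proof.
move=> cJ cK gk JX.
have [N MN rkN] := generic_rank_attained F' (submx_of J K Bbar).
pose r := cast_ord (esym cJ); pose q := cast_ord (esym cK).
have : row_free (mxsub r q N).
  rewrite /row_free eqn_leq rank_leq_row /= -{1}gk -rkN -{1}[N]mxsub_id.
  apply: rank_mxsub_le => i /=; [exists (cast_ord cJ i)|exists (cast_ord cK i)];
    exact: val_inj.
rewrite row_free_det => /det_neq0_perm [s Ns].
pose f c := @enum_val _ (mem J) (r c).
have f_inj : injective f by move=> a b /enum_val_inj /cast_ord_inj.
have fJ : f @: 'I_k = J.
  apply/eqP; rewrite eqEcard card_imset // card_ord cJ leqnn andbT.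
  by apply/fintype.subsetP => _ /imsetP [c _ ->]; apply: enum_valP.
exists f, (fun c => @enum_val _ (mem K) (q (s c))); split.
- by move=> a b /enum_val_inj /cast_ord_inj /perm_inj.
- by move=> c; apply: contraTT (Ns c) => nB; rewrite !mxE MN ?eqxx // mxE.
- by rewrite -imset_full_rank_sets // fJ.
Qed.

Lemma vertex_eqE (n l p : nat) (k : 'I_p -> nat) :
  (forall u u', (input_vertex n k u == input_vertex n k u' :> ism_vertex n l k)
     = (u == u')) *
  (forall s s', (state_vertex l k s == state_vertex l k s' :> ism_vertex n l k)
     = (s == s')) *
  (forall i (m m' : 'I_(k i)),
     (mode_vertex n l m == mode_vertex n l m') = (m == m')) *
  (forall u s, (input_vertex n k u == state_vertex l k s) = false) *
  (forall u s, (state_vertex l k s == input_vertex n k u) = false) *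
  (forall u i (m : 'I_(k i)),
     (input_vertex n k u == mode_vertex n l m) = false) *
  (forall u i (m : 'I_(k i)),
     (mode_vertex n l m == input_vertex n k u) = false) *
  (forall s i (m : 'I_(k i)),
     (state_vertex l k s == mode_vertex n l m) = false) *
  (forall s i (m : 'I_(k i)),
     (mode_vertex n l m == state_vertex l k s) = false).
Proof.
do !split=> //; move=> i m m'.
by rewrite -[LHS]/(Tagged (fun i => 'I_(k i)) m == Tagged (fun i => 'I_(k i)) m')
           eq_Tagged.
Qed.

(** The modes are distributed among the states by a nonzero term in the Leibniz
    expansion of the determinant of the chosen columns. *)
Lemma matched_paths (F : fieldType) (n l p : nat) (k : 'I_p -> nat)
    (X : forall i, 'M[F]_(n, k i)) (Bbar : 'M[bool]_(n, l)) (i : 'I_p)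
    (f : 'I_(k i) -> 'I_n) (g : 'I_(k i) -> 'I_l) :
    matched (X i) Bbar f g ->
  exists P : 'I_(k i) -> seq (ism_vertex n l k),
    [/\ forall r, input_state_mode_path X Bbar i (P r),
        forall r r', r != r' -> [disjoint P r & P r'] &
        states_on P \in full_rank_sets (X i)].
Proof.
move=> [g_inj Bfg detf]; have f_inj := colsub_det_inj detf.
(* Transposed, so that the permutation sends states to modes. *)
have : \det (colsub f (X i)^T)^T != 0 by rewrite det_tr.
move=> /det_neq0_perm [s Xs].
pose P r : seq (ism_vertex n l k) :=
  [:: input_vertex n k (g r); state_vertex l k (f r); mode_vertex n l (s r)].
exists P; split.
- move=> r; exists (g r), (f r), (s r); split=> //=.
  by rewrite Bfg /=; move: (Xs r); rewrite !mxE andbT.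
- move=> r r' rr'; rewrite disjoint_has; apply/hasPn => v.
  rewrite !inE => /or3P [] /eqP ->; rewrite !vertex_eqE ?orbF /=.
  + by rewrite (inj_eq g_inj).
  + by rewrite (inj_eq f_inj).
  + by rewrite (inj_eq perm_inj).
- have -> : states_on P = f @: 'I_(k i); last by rewrite imset_full_rank_sets.
  apply/setP => x; rewrite inE; apply/existsP/imsetP => -[r].
    by rewrite !inE !vertex_eqE orbF /= => /eqP xf; exists r.
  by move=> _ ->; exists r; rewrite !inE eqxx orbT.
Qed.

Lemma paths_matched (F : fieldType) (n l p : nat) (k : 'I_p -> nat)
    (X : forall i, 'M[F]_(n, k i)) (Bbar : 'M[bool]_(n, l)) (i : 'I_p)
    (P : 'I_(k i) -> seq (ism_vertex n l k)) :
    (forall r, input_state_mode_path X Bbar i (P r)) ->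
    (forall r r', r != r' -> [disjoint P r & P r']) ->
    states_on P \in full_rank_sets (X i) ->
  exists f g, matched (X i) Bbar f g.
Proof.
move=> /choice [g] /choice [f] /choice [m] paths disj.
have PE r := (paths r).1.
have f_inj : injective f.
  move=> a b fab; apply/eqP; apply: contraT => /disj.
  rewrite !PE disjoint_has => /hasPn /(_ (state_vertex l k (f a))).
  by rewrite !inE fab eqxx !orbT => /(_ isT).
have g_inj : injective g.
  move=> a b gab; apply/eqP; apply: contraT => /disj.
  rewrite !PE disjoint_has => /hasPn /(_ (input_vertex n k (g a))).
  by rewrite !inE gab eqxx => /(_ isT).
have -> : states_on P = f @: 'I_(k i).
  apply/setP => x; rewrite inE; apply/existsP/imsetP => -[r].
    by rewrite PE !inE !vertex_eqE orbF /= => /eqP xf; exists r.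
  by move=> _ ->; exists r; rewrite PE !inE eqxx orbT.
rewrite imset_full_rank_sets // => detf; exists f, g; split=> // c.
by have [_ /= /andP []] := paths c.
Qed.

(** * Full rank conditions for matrices with a given pattern *)

Lemma row_free_minor (F : fieldType) (k l : nat) (M : 'M[F]_(k, l)) :
  row_free M <-> exists g : 'I_k -> 'I_l, \det (colsub g M) != 0.
Proof.
split=> [M_free | [g]].
  have MT_full : row_full M^T by rewrite /row_full mxrank_tr.
  exists (fullrankfun MT_full); rewrite -det_tr -unitfE -unitmxE.
  by rewrite trmx_mxsub fullrowsub_unit.
rewrite -row_free_det /row_free => /eqP rk; apply/eqP/anti_leq.
rewrite rank_leq_row -{1}rk -[M in (_ <= \rank M)%N]mxsub_id.
by apply: rank_mxsub_le => i; [exists i | exists (g i)].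
Qed.

(** The pattern is realized over the reals while the eigenbases are complex;
    the morphism phi is the embedding of the former into the latter. *)
Section ScalarExtension.
Variables (F' F : fieldType) (phi : {rmorphism F' -> F}) (n l : nat).
Implicit Types (B D : 'M[F']_(n, l)) (Bbar : 'M[bool]_(n, l)).

(** A nonzero term of the expansion of a maximal minor of X^T B has a product
    of entries of B, which must then be free, and a minor of X^T. *)
Lemma full_rank_matched k (X : 'M[F]_(n, k)) Bbar B :
    has_pattern Bbar B -> row_free (X^T *m map_mx phi B) ->
  exists f g, matched X Bbar f g.
Proof.
move=> pB /row_free_minor [g detg]; have g_inj := colsub_det_inj detg.
move: detg; rewrite -mulmx_colsub det_mulmx_colsub => sum_neq0.
have /existsP [f] : [exists f : {ffun 'I_k -> 'I_n},
    (\prod_c colsub g (map_mx phi B) (f c) c) * \det (colsub f X^T) != 0].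
  apply: contraNT sum_neq0 => /existsPn f0.
  by rewrite big1 // => f _; apply/eqP; move: (f0 f); rewrite negbK.
rewrite mulf_eq0 negb_or => /andP [/prodf_neq0 Bf detf].
exists f, g; split=> // c; apply: contraTT (Bf c isT) => /pB Bfg0.
by rewrite !mxE Bfg0 rmorph0 eqxx.
Qed.

(** The columns g of the product are exactly the columns f of X^T. *)
Lemma matched_full_rank k (X : 'M[F]_(n, k)) Bbar f g :
  matched X Bbar f g -> row_free (X^T *m map_mx phi (matching_mx F' f g)).
Proof.
move=> [g_inj _ detf]; apply/row_free_minor; exists g.
rewrite -mulmx_colsub -map_mxsub colsub_matching_mx //.
by rewrite map_mxsub map_mx1 mulmx_colsub mulmx1.
Qed.

(** A maximal minor of Y (B + t D) is a polynomial in t, and it is not zero as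
    soon as it has a nonzero value. *)
Lemma pencil_full_rank k (Y : 'M[F]_(k, n)) B D (t0 : F') :
    row_free (Y *m map_mx phi (B + t0 *: D)) ->
  exists2 p : {poly F}, p != 0 &
    forall t, ~~ root p (phi t) -> row_free (Y *m map_mx phi (B + t *: D)).
Proof.
move=> /row_free_minor [g detg].
pose M := map_mx polyC (colsub g (Y *m map_mx phi B))
          + 'X *: map_mx polyC (colsub g (Y *m map_mx phi D)).
have pE t : (\det M).[phi t] = \det (colsub g (Y *m map_mx phi (B + t *: D))).
  rewrite -[LHS]/(horner_eval (phi t) (\det M)) -det_map_mx; congr (\det _).
  apply/matrixP => a b; rewrite [in RHS]map_mxD [in RHS]map_mxZ mulmxDr.
  by rewrite -scalemxAr /M !mxE /= /horner_eval hornerD hornerM hornerX !hornerC.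
exists (\det M) => [|t].
  by apply: contraNneq detg => M0; rewrite -pE M0 horner0.
by rewrite /root pE => detg'; apply/row_free_minor; exists g.
Qed.
End ScalarExtension.

Lemma nat_not_root (F : numDomainType) (p : {poly F}) :
  p != 0 -> exists t : nat, ~~ root p t%:R.
Proof.
move=> p0; pose s : seq F := [seq t%:R | t <- iota 0 (size p)].
have /allPn [_ /mapP [t _ ->] nr] : ~~ all (root p) s.
  apply: contraTN isT => /(max_poly_roots p0).
  rewrite map_inj_uniq ?iota_uniq => [|a b /eqP]; last by rewrite eqr_nat => /eqP.
  by rewrite size_map size_iota ltnn => /(_ isT).
by exists t.
Qed.

Lemma has_pattern_pencil (F : fieldType) (m r : nat) (M : 'M[bool]_(m, r))
    (B D : 'M[F]_(m, r)) (t : F) :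
  has_pattern M B -> has_pattern M D -> has_pattern M (B + t *: (D - B)).
Proof.
by move=> pB pD i j nM; rewrite !mxE (pB i j nM) (pD i j nM) subrr mulr0 addr0.
Qed.

(** The conditions are imposed one after the other.  If B satisfies the earlier
    ones and D the new one, each of them fails at finitely many points of the
    line through B (t = 0) and D (t = 1), and the line contains infinitely many
    points with t a natural number. *)
Lemma common_full_rank (F' F : numFieldType) (phi : {rmorphism F' -> F})
    (n l p : nat) (k : 'I_p -> nat) (Y : forall i, 'M[F]_(k i, n))
    (Bbar : 'M[bool]_(n, l)) :
    (forall i, exists2 B, has_pattern Bbar B & row_free (Y i *m map_mx phi B)) ->
  exists2 B, has_pattern Bbar B & forall i, row_free (Y i *m map_mx phi B).
Proof.
move=> each.
suff [B pB freeB] : exists2 B, has_pattern Bbar B &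
    {in enum 'I_p, forall i, row_free (Y i *m map_mx phi B)}.
  by exists B => // i; apply: freeB; rewrite mem_enum.
elim: (enum 'I_p) => [|i s [B pB freeB]]; first by exists 0 => // a b; rewrite mxE.
have [D pD freeD] := each i.
have [q q0 qP] : exists2 q : {poly F}, q != 0 & forall t, ~~ root q (phi t) ->
    {in s, forall j, row_free (Y j *m map_mx phi (B + t *: (D - B)))}.
  elim: s freeB => [|j s IHs] freeB; first by exists 1; rewrite ?oner_neq0.
  have [|q q0 qP] := IHs; first by move=> a sa; apply: freeB; rewrite inE sa orbT.
  have [|r r0 rP] := @pencil_full_rank _ _ phi _ _ _ (Y j) B (D - B) 0.
    by rewrite scale0r addr0; apply: freeB; rewrite inE eqxx.
  exists (r * q) => [|t]; first by rewrite mulf_neq0.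
  rewrite rootM negb_or => /andP [rt qt] a.
  by rewrite inE => /predU1P [->|]; [apply: rP | apply: qP].
have [|r r0 rP] := @pencil_full_rank _ _ phi _ _ _ (Y i) B (D - B) 1.
  by rewrite scale1r addrC subrK.
have [t] : exists t : nat, ~~ root (r * q) t%:R.
  by apply: nat_not_root; rewrite mulf_neq0.
rewrite -(rmorph_nat phi) rootM negb_or => /andP [rt qt].
exists (B + t%:R *: (D - B)); first exact: has_pattern_pencil.
by move=> a; rewrite inE => /predU1P [->|]; [apply: rP | apply: qP].
Qed.

(** A left eigenvector for lambda_i is w X_i^T with w nonzero, so B annihilates
    one of them if and only if X_i^T B has a nontrivial left kernel. *)
Lemma eigenbasis_hautus (R : rcfType) (n l p : nat) (A : 'M[R]_n)
    (B : 'M[R]_(n, l)) (lam : 'I_p -> R[i])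
    (X : forall i : 'I_p, 'M[R[i]]_(n, geo_mult A (lam i))) :
    distinct_eigenvalues A lam -> (forall i, left_eigenbasis (X i)) ->
  (forall i, row_free ((X i)^T *m map_mx (real_complex R) B)) <->
  (forall z (v : 'rV[R[i]]_n), v *m complex_mx A = z *: v ->
     v *m map_mx (real_complex R) B = 0 -> v = 0).
Proof.
move=> [_ lamP] hX; split=> [freeB z v vA vB | hautus i].
  apply/eqP; apply: contraT => v0.
  have /lamP [i zE] : eigenvalue (complex_mx A) z by apply/eigenvalueP; exists v.
  have [_ /andP [_ kerX]] := hX i.
  have /submxP [w vE] : (v <= (X i)^T)%MS.
    apply: submx_trans kerX; apply/sub_kermxP.
    by rewrite mulmxBr mul_mx_scalar vA zE subrr.
  move: vB; rewrite vE -mulmxA => /eqP; rewrite mulmx_free_eq0 // => /eqP w0.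
  by rewrite vE w0 mul0mx eqxx in v0.
have [X_free /andP [Xker _]] := hX i.
rewrite -kermx_eq0; apply/rowV0P => w /sub_kermxP; rewrite mulmxA => wB.
apply/eqP; rewrite -(mulmx_free_eq0 _ X_free); apply/eqP.
apply: hautus (lam i) _ _ wB; apply/esym/eqP; rewrite -subr_eq0.
have /sub_kermxP : (w *m (X i)^T <= kermx ((lam i)%:M - complex_mx A))%MS.
  by apply: submx_trans Xker; apply: submxMl.
by rewrite mulmxBr mul_mx_scalar => ->.
Qed.

(** * Necessity of the Hautus condition *)

Lemma gram_eq0 (R : realDomainType) (m n : nat) (M : 'M[R]_(m, n)) :
  (forall i, (M *m M^T) i i = 0) -> M = 0.
Proof.
move=> diag0; apply/matrixP => i j.
have sum0 : \sum_k M i k ^+ 2 = 0.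
  by rewrite -[RHS](diag0 i) mxE; apply: eq_bigr => k _; rewrite mxE.
move/psumr_eq0P: sum0 => /(_ (fun k _ => sqr_ge0 (M i k)) j isT) /eqP.
by rewrite sqrf_eq0 mxE => /eqP.
Qed.

Section Trajectories.
Local Open Scope classical_set_scope.
Local Open Scope ring_scope.

Lemma Re_mulmx (R : rcfType) (m n : nat) (v : 'rV[R[i]]_m) (M : 'M[R]_(m, n)) :
  map_mx (@complex.Re R) (v *m map_mx (real_complex R) M)
    = map_mx (@complex.Re R) v *m M.
Proof.
apply/matrixP => i j; rewrite !mxE.
rewrite (big_morph (@complex.Re R) (id1 := 0) (op1 := +%R)) //.
  apply: eq_bigr => s _; rewrite !mxE; case: (v i s) => a b /=.
  by rewrite mulr0 subr0.
by move=> [a b] [c d].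
Qed.

Lemma Im_mulmx (R : rcfType) (m n : nat) (v : 'rV[R[i]]_m) (M : 'M[R]_(m, n)) :
  map_mx (@complex.Im R) (v *m map_mx (real_complex R) M)
    = map_mx (@complex.Im R) v *m M.
Proof.
apply/matrixP => i j; rewrite !mxE.
rewrite (big_morph (@complex.Im R) (id1 := 0) (op1 := +%R)) //.
  apply: eq_bigr => s _; rewrite !mxE; case: (v i s) => a b /=.
  by rewrite mulr0 add0r.
by move=> [a b] [c d].
Qed.

Lemma is_derive_mulmx (R : realType) (m n : nat) (M : 'M[R]_(m, n))
    (y : R -> 'cV[R]_n) (y' : 'cV[R]_n) (t : R) (i : 'I_m) :
    (forall j, is_derive t 1 (fun s => y s j 0) (y' j 0)) ->
  is_derive t 1 (fun s => (M *m y s) i 0) ((M *m y') i 0).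
Proof.
move=> dy.
have -> : (fun s => (M *m y s) i 0) = \sum_j (M i j \*: (fun s => y s j 0)).
  by apply/funext => s; rewrite !mxE fct_sumE.
by rewrite mxE; apply: is_derive_sum => j; apply: is_deriveZ.
Qed.

Lemma is_derive_continuous (R : realType) (f f' : R -> R) :
  (forall t : R, is_derive t 1 f (f' t)) -> continuous f.
Proof.
by move=> df t; apply/differentiable_continuous/derivable1_diffP/ex_derive.
Qed.

Lemma continuous_within_mulmx (R : realType) (m n : nat) (M : 'M[R]_(m, n))
    (y : R -> 'cV[R]_n) (D : set R) (i : 'I_m) :
    (forall j, {within D, continuous (fun s => y s j 0)}) ->
  {within D, continuous (fun s => (M *m y s) i 0)}.
Proof.
move=> cy.
have -> : (fun s => (M *m y s) i 0) = \sum_j (M i j \*: (fun s => y s j 0)).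
  by apply/funext => s; rewrite !mxE fct_sumE.
elim/big_ind: _ => [|f g cf cg|j _].
- by move=> s; apply: cst_continuous.
- by move=> s; apply: continuousD; [apply: cf | apply: cg].
- by move=> s; apply: continuousZl_tmp; apply: cy.
Qed.

(** With v = p + i q and z = al + i be, the real functions a = p x and b = q x
    satisfy a' = al a - be b and b' = be a + al b, whatever the input is.  Hence
    (a^2 + b^2) exp(-2 al t) is constant, and no state with a nonzero value of
    p x or q x is reachable from 0. *)
Lemma controllable_hautus (R : realType) (n l : nat) (A : 'M[R]_n)
    (B : 'M[R]_(n, l)) (z : R[i]) (v : 'rV[R[i]]_n) :
    controllable A B -> v *m complex_mx A = z *: v ->
    v *m map_mx (real_complex R) B = 0 ->
  v = 0.
Proof.
move=> ctrl vA vB.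
pose p := map_mx (@complex.Re R) v; pose q := map_mx (@complex.Im R) v.
pose al := complex.Re z; pose be := complex.Im z.
have pA : p *m A = al *: p - be *: q.
  rewrite -Re_mulmx -[map_mx (real_complex R) A]/(complex_mx A) vA.
  by apply/matrixP => i j; rewrite !mxE /al /be; case: (z) => a b; case: (v i j).
have qA : q *m A = be *: p + al *: q.
  rewrite -Im_mulmx -[map_mx (real_complex R) A]/(complex_mx A) vA.
  apply/matrixP => i j; rewrite !mxE /al /be; case: (z) => a b; case: (v i j) => c d /=.
  by rewrite addrC.
have pB : p *m B = 0 by rewrite -Re_mulmx vB; apply/matrixP => i j; rewrite !mxE.
have qB : q *m B = 0 by rewrite -Im_mulmx vB; apply/matrixP => i j; rewrite !mxE.
have unreachable (x1 : 'cV[R]_n) : (p *m x1) 0 0 = 0 /\ (q *m x1) 0 0 = 0.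
  have [T [u [x [T0 [_ cx dx] x0E <-]]]] := ctrl 0 x1.
  pose a s : R := (p *m x s) 0 0; pose b s : R := (q *m x s) 0 0.
  pose e := expR \o ((- (2 * al)) \*: (id : R -> R)).
  have ca : {within `[0, T], continuous a} by apply: continuous_within_mulmx.
  have cb : {within `[0, T], continuous b} by apply: continuous_within_mulmx.
  have da (t : R) : 0 < t < T -> is_derive t 1 a (al * a t - be * b t).
    move=> tT; apply: is_derive_eq.
      exact: (is_derive_mulmx p 0 (fun i => dx i t tT)).
    by rewrite mulmxDr !mulmxA pA pB mul0mx addr0 mulmxBl -!scalemxAl /a /b !mxE.
  have db (t : R) : 0 < t < T -> is_derive t 1 b (be * a t + al * b t).
    move=> tT; apply: is_derive_eq.
      exact: (is_derive_mulmx q 0 (fun i => dx i t tT)).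
    by rewrite mulmxDr !mulmxA qA qB mul0mx addr0 mulmxDl -!scalemxAl /a /b !mxE.
  have de (t : R) : is_derive t 1 e (- (2 * al) * e t).
    by apply: is_derive_eq; rewrite /= scaler1 mulrC.
  have ce : {within `[0, T], continuous e}.
    by apply: continuous_subspaceT; apply: is_derive_continuous de.
  have [||c cT] := @MVT R ((a * a + b * b) * e) (fun=> 0) 0 T T0.
  - move=> t; rewrite in_itv /= => /[dup] /da dat /db dbt.
    apply: (is_derive_eq (is_deriveM
      (is_deriveD (is_deriveM dat dat) (is_deriveM dbt dbt)) (de t))).
    by rewrite !fctE /GRing.scale /=; ring.
  - move=> t; apply: continuousM; last exact: ce.
    by apply: continuousD; apply: continuousM;
      [apply: ca|apply: ca|apply: cb|apply: cb].
  rewrite mul0r /= !fctE.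
  have -> : a 0 = 0 by rewrite /a x0E mulmx0 mxE.
  have -> : b 0 = 0 by rewrite /b x0E mulmx0 mxE.
  rewrite !mul0r addr0 mul0r subr0 => /eqP.
  rewrite mulf_eq0 /e /= (gt_eqF (expR_gt0 _)) orbF -!expr2.
  by rewrite paddr_eq0 ?sqr_ge0 // !sqrf_eq0 => /andP [/eqP aT /eqP bT].
have norm0 (w : 'rV[R]_n) : (w *m w^T) 0 0 = 0 -> w = 0.
  by move=> w0; apply: gram_eq0 => i; rewrite !ord1.
(* The targets p^T and q^T give the squared norms of p and q. *)
have p0 := norm0 p (unreachable p^T).1; have q0 := norm0 q (unreachable q^T).2.
apply/rowP => j; move: (congr1 (fun w : 'rV[R]_n => w 0 j) p0)
  (congr1 (fun w : 'rV[R]_n => w 0 j) q0).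
by rewrite !mxE; case: (v 0 j) => a b /= -> ->.
Qed.
End Trajectories.

(** * Two-point Hermite interpolation *)

Lemma vanishing_jet (F : comNzRingType) (c : F) (r : {poly F}) (m k : nat) :
  (k < m)%N -> (r * ('X - c%:P) ^+ m)^`(k).[c] = 0.
Proof.
elim: k r m => [|k IHk] r [//|m] km.
  by rewrite derivn0 exprSr mulrA !hornerE subrr mulr0.
rewrite derivSn.
have -> : (r * ('X - c%:P) ^+ m.+1)^`()
    = (r^`() * ('X - c%:P) + r *+ m.+1) * ('X - c%:P) ^+ m.
  by rewrite derivM deriv_exp derivXsubC mul1r /= exprS mulrnAr
    [RHS]mulrDl mulrnAl mulrA.
exact: IHk.
Qed.

Lemma derivn_comp_XsubC (F : comNzRingType) (c : F) (r : {poly F}) (k : nat) :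
  (r \Po ('X - c%:P))^`(k) = r^`(k) \Po ('X - c%:P).
Proof.
by elim: k => // k IHk; rewrite !derivnS IHk deriv_comp derivXsubC mulr1.
Qed.

(** The Taylor polynomial at c. *)
Lemma prescribed_jet (F : numFieldType) (c : F) (m : nat) (a : nat -> F) :
  exists r : {poly F}, forall k, (k < m)%N -> r^`(k).[c] = a k.
Proof.
exists ((\poly_(k < m) (a k / k`!%:R)) \Po ('X - c%:P)) => k km.
rewrite derivn_comp_XsubC horner_comp !hornerE subrr horner_coef0 coef_derivn addn0.
by rewrite coef_poly km ffactnn -[LHS]mulr_natr divfK.
Qed.

(** The jets of order m at 0 and 1 are the residues modulo X^m and (X - 1)^m;
    these are coprime, so the Chinese remainder theorem applies. *)
Lemma two_point_hermite (F : numFieldType) (m : nat) (a b : nat -> F) :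
  exists r : {poly F}, forall k, (k < m)%N ->
    r^`(k).[0] = a k /\ r^`(k).[1] = b k.
Proof.
have [ra raP] := prescribed_jet 0 m a; have [rb rbP] := prescribed_jet 1 m b.
pose P0 : {poly F} := ('X - 0%:P) ^+ m; pose P1 : {poly F} := ('X - 1%:P) ^+ m.
have /Bezout_eq1_coprimepP [[u v] /= uv] : coprimep P0 P1.
  by apply/coprimep_expl/coprimep_expr/coprimep_XsubC2; rewrite subr0 oner_eq0.
exists (ra * (v * P1) + rb * (u * P0)) => k km; split.
  rewrite -[RHS](raP k km).
  have -> : ra * (v * P1) + rb * (u * P0) = ra + ((rb - ra) * u) * P0.
    by rewrite -[v * P1](addKr (u * P0)) uv; ring.
  by rewrite derivnD hornerD vanishing_jet // addr0.
rewrite -[RHS](rbP k km).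
have -> : ra * (v * P1) + rb * (u * P0) = rb + ((ra - rb) * v) * P1.
  by rewrite -[u * P0](addrK (v * P1)) uv; ring.
by rewrite derivnD hornerD vanishing_jet // addr0.
Qed.

(** * Coefficients of the adjugate of s - A *)

Section ResolventCoefficients.
Variables (R : comNzRingType) (n : nat) (A : 'M[R]_n).
Local Notation c := (char_poly A).

(** The coefficient of s^k in adj(s - A) = (chi(s) - chi(A)) / (s - A), written
    out explicitly so that its vanishing for k >= n is immediate. *)
Definition resolvent_coef (k : nat) : 'M[R]_n :=
  \sum_(j < n) c`_(k + j).+1 *: A ^+ j.

Lemma resolvent_coef_ge (k : nat) : (n <= k)%N -> resolvent_coef k = 0.
Proof.
move=> nk; rewrite /resolvent_coef big1 // => j _.
by rewrite nth_default ?scale0r // size_char_poly ltnS (leq_trans nk) ?leq_addr.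
Qed.

(** The Cayley-Hamilton theorem in a form that includes the empty matrix. *)
Lemma horner_char_poly : \sum_(j < n.+1) c`_j *: A ^+ j = 0.
Proof.
case: n A => [|n'] M; first by rewrite [LHS]flatmx0 [RHS]flatmx0.
rewrite -[RHS](Cayley_Hamilton M) -[in RHS](coefK (char_poly M)) poly_def.
rewrite rmorph_sum /= size_char_poly; apply: eq_bigr => j _.
by rewrite linearZ /= rmorphXn /= horner_mx_X.
Qed.

(** The coefficient of s^k in (s - A) adj(s - A) = chi(s). *)
Lemma mulmx_resolvent_coef (k : nat) :
  A *m resolvent_coef k
    = (if k is k'.+1 then resolvent_coef k' else 0) - (c`_k)%:M.
Proof.
have AN : A *m resolvent_coef k + (c`_k)%:M = \sum_(j < n.+1) c`_(k + j) *: A ^+ j.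
  rewrite big_ord_recl /= addn0 expr0 scalemx1 addrC; congr (_ + _).
  rewrite mulmx_sumr; apply: eq_bigr => j _.
  by rewrite -scalemxAr mulmxE -exprS addnS.
apply: (addIr (c`_k)%:M); rewrite subrK AN; case: k {AN} => [|k].
  exact: horner_char_poly.
rewrite big_ord_recr /= nth_default ?scale0r ?addr0.
  by apply: eq_bigr => j _; rewrite addSn.
by rewrite size_char_poly ltnS leq_addl.
Qed.
End ResolventCoefficients.

(** * Sufficiency of the Hautus condition *)

Section Reachability.
Variables (R : rcfType) (n l : nat) (A : 'M[R]_n) (B : 'M[R]_(n, l)).
Local Notation N := (resolvent_coef A).

(** The Gram matrix of the block row (N_0 B ... N_n B); it is invertible if and
    only if that block row has rank n, and its inverse then gives preimages. *)
Definition resolvent_gramian : 'M[R]_n :=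
  \sum_(k < n.+1) (N k *m B) *m (N k *m B)^T.

(** V G V^T is the sum of the Gram matrices of the V N_k B, whose diagonals are
    nonnegative. *)
Lemma ker_resolvent_gramian (m : nat) (V : 'M[R]_(m, n)) :
  V *m resolvent_gramian = 0 <-> forall k, V *m (N k *m B) = 0.
Proof.
split=> [VG k | VN]; last first.
  by rewrite mulmx_sumr big1 // => k _; rewrite mulmxA VN mul0mx.
have [kn|nk] := ltnP k n.+1; last first.
  by rewrite resolvent_coef_ge ?mul0mx ?mulmx0 // ltnW.
apply: gram_eq0 => i.
have sum0 : \sum_(j < n.+1)
    (V *m (N j *m B) *m (V *m (N j *m B))^T) i i = 0.
  transitivity ((V *m resolvent_gramian *m V^T) i i).
    rewrite mulmx_sumr mulmx_suml summxE; apply: eq_bigr => j _.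
    by rewrite [(V *m _)^T]trmx_mul !mulmxA.
  by rewrite VG mul0mx mxE.
move/psumr_eq0P: sum0 => /(_ _ (Ordinal kn) isT) -> // j _.
by rewrite mxE; apply: sumr_ge0 => s _; rewrite [X in _ * X]mxE -expr2 sqr_ge0.
Qed.

(** The left kernel of all the N_k B is annihilated by B, because N_(n-1) = 1,
    and then stable under A, because A N_k = N_(k-1) - c_k.  If it were not
    zero, it would contain a complex left eigenvector of A, against the Hautus
    condition. *)
Lemma resolvent_gramian_unit :
    (forall z (v : 'rV[R[i]]_n), v *m complex_mx A = z *: v ->
       v *m map_mx (real_complex R) B = 0 -> v = 0) ->
  resolvent_gramian \in unitmx.
Proof.
move=> hautus; rewrite -row_free_unit -kermx_eq0 -mxrank_eq0 -leqn0 leqNgt.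
apply/negP => rk_gt0; pose V := row_base (kermx resolvent_gramian).
have VN k : V *m (N k *m B) = 0.
  move: k; apply/ker_resolvent_gramian/sub_kermxP; rewrite eq_row_base.
  exact: submx_refl.
have VNpred k : V *m ((if k is k'.+1 then N k' else 0) *m B) = 0.
  by case: k => [|k]; rewrite ?VN // mul0mx mulmx0.
(* The recurrence at k = n, where N_n = 0 and c_n = 1, reads N_(n-1) = 1. *)
have VB : V *m B = 0.
  have := mulmx_resolvent_coef A n; rewrite resolvent_coef_ge // mulmx0.
  have /monicP := char_poly_monic A.
  rewrite /lead_coef size_char_poly /= => -> /eqP; rewrite eq_sym subr_eq0 => /eqP M1.
  by rewrite -[B]mul1mx -M1 VNpred.
have VAN k : V *m A *m (N k *m B) = 0.
  rewrite -mulmxA [A *m _]mulmxA mulmx_resolvent_coef mulmxBl mulmxBr.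
  rewrite mul_scalar_mx -scalemxAr VB scaler0 subr0.
  exact: VNpred.
have /submxP [M VA] : (V *m A <= V)%MS.
  by rewrite eq_row_base; apply/sub_kermxP/ker_resolvent_gramian.
have [z /eigenvalueP [w wM w0]] :=
  eigenvalue_closed (map_mx (real_complex R) M) rk_gt0.
have : w *m map_mx (real_complex R) V = 0.
  apply: (hautus z).
    by rewrite -mulmxA -map_mxM VA map_mxM mulmxA wM scalemxAl.
  by rewrite -mulmxA -map_mxM VB map_mx0 mulmx0.
have V_free : row_free (map_mx (real_complex R) V).
  by rewrite row_free_map row_base_free.
by move/eqP; rewrite mulmx_free_eq0 // (negPf w0).
Qed.

Lemma resolvent_span (x : 'cV[R]_n) :
    resolvent_gramian \in unitmx ->
  exists a : nat -> 'cV[R]_l, x = \sum_(k < n.+1) N k *m B *m a k.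
Proof.
move=> G_unit.
exists (fun k => (N k *m B)^T *m (invmx resolvent_gramian *m x)).
by under eq_bigr do rewrite mulmxA; rewrite -mulmx_suml mulKVmx.
Qed.
End Reachability.

(** Writing J k for the vector of the k-th derivatives of phi, the input
    u = sum_k c_k J k drives x = sum_k N_k B J k: by the recurrence for N,
    A x + B u = sum_k N_(k-1) B J k with N_(-1) = 0, and this is x'.  Hermite
    interpolation fixes J k at 0 and 1 so that x has the prescribed ends. *)
Lemma hautus_controllable (R : realType) (n l : nat) (A : 'M[R]_n)
    (B : 'M[R]_(n, l)) :
    (forall z (v : 'rV[R[i]]_n), v *m complex_mx A = z *: v ->
       v *m map_mx (real_complex R) B = 0 -> v = 0) ->
  controllable A B.
Proof.
move=> /resolvent_gramian_unit G_unit x0 x1.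
have [a0 ->] := resolvent_span x0 G_unit; have [a1 ->] := resolvent_span x1 G_unit.
have /choice [phi phiP] (j : 'I_l) := two_point_hermite n.+1
  (fun k => a0 k j 0) (fun k => a1 k j 0).
pose J k (t : R) : 'cV[R]_l := \col_j (phi j)^`(k).[t].
have dJ k (t : R) j : is_derive t 1 (fun s => J k s j 0) (J k.+1 t j 0).
  have -> : (fun s => J k s j 0) = horner (phi j)^`(k).
    by apply/funext => s; rewrite mxE.
  by rewrite mxE derivnS; apply: is_derive_poly.
have dcomb r (C : nat -> 'M[R]_(r, l)) i (t : R) :
    is_derive t 1 (fun s => (\sum_(k < n.+1) C k *m J k s) i 0)
      ((\sum_(k < n.+1) C k *m J k.+1 t) i 0).
  have -> : (fun s => (\sum_(k < n.+1) C k *m J k s) i 0)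
      = \sum_(k < n.+1) (fun s => (C k *m J k s) i 0).
    by apply/funext => s; rewrite summxE fct_sumE.
  by rewrite summxE; apply: is_derive_sum => k; apply: is_derive_mulmx.
pose u t := \sum_(k < n.+1) ((char_poly A)`_k)%:M *m J k t.
pose x t := \sum_(k < n.+1) resolvent_coef A k *m B *m J k t.
have xu t : \sum_(k < n.+1) resolvent_coef A k *m B *m J k.+1 t
    = A *m x t + B *m u t.
  rewrite big_ord_recr /= resolvent_coef_ge // !mul0mx addr0.
  rewrite /x /u !mulmx_sumr -big_split big_ord_recl /=.
  rewrite !mulmxA mulmx_resolvent_coef sub0r mul_mx_scalar !mulNmx.
  rewrite mul_scalar_mx addNr add0r.
  apply: eq_bigr => k _; rewrite !mulmxA mulmx_resolvent_coef mul_mx_scalar.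
  by rewrite mulmxBl mul_scalar_mx -mulmxDl subrK.
have dx i (t : R) : is_derive t 1 (fun s => x s i 0) ((A *m x t + B *m u t) i 0).
  by rewrite -xu; apply: (dcomb _ (fun k => resolvent_coef A k *m B)).
have JE t (a : nat -> 'cV[R]_l) :
  (forall k j, (k < n.+1)%N -> (phi j)^`(k).[t] = a k j 0) ->
  x t = \sum_(k < n.+1) resolvent_coef A k *m B *m a k.
  move=> ja; apply: eq_bigr => k _; congr (_ *m _); apply/colP => j.
  by rewrite mxE ja.
exists 1, u, x; split; first exact: ltr01.
- split=> [j|i|i t _]; last exact: dx.
    pose c k : 'M[R]_l := ((char_poly A)`_k)%:M.
    by apply: continuous_subspaceT; apply: is_derive_continuous (dcomb _ c j).
  by apply: continuous_subspaceT; apply: is_derive_continuous (dx i).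
- by apply: (JE 0 a0) => k j /(phiP j) [].
- by apply: (JE 1 a1) => k j /(phiP j) [].
Qed.

(** * The equivalence *)

Theorem theorem1 (R : realType) (n l p : nat) (A : 'M[R]_n)
    (Bbar : 'M[bool]_(n, l)) (lam : 'I_p -> R[i])
    (hlam : distinct_eigenvalues A lam)
    (X : forall i : 'I_p, 'M[R[i]]_(n, geo_mult A (lam i)))
    (hX : forall i : 'I_p, left_eigenbasis (X i)) :
  [<->
    (* (a) *)
    exists B : 'M[R]_(n, l), has_pattern Bbar B /\ controllable A B;
    (* (b) *)
    forall i : 'I_p, exists (J : {set 'I_n}) (K : {set 'I_l}),
      [/\ #|J| = geo_mult A (lam i), #|K| = geo_mult A (lam i),
          generic_rank R (submx_of J K Bbar) = geo_mult A (lam i) &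
          J \in full_rank_sets (X i)];
    (* (c) *)
    forall i : 'I_p,
      exists P : 'I_(geo_mult A (lam i)) ->
                 seq (ism_vertex n l (fun j : 'I_p => geo_mult A (lam j))),
        [/\ forall r, input_state_mode_path X Bbar i (P r),
            forall r r', r != r' -> [disjoint P r & P r'] &
            states_on P \in full_rank_sets (X i)]].
Proof.
have hautus B := eigenbasis_hautus B hlam hX.
tfae.
- move=> [B [pB ctrl]] i.
  have /hautus freeB : forall z (v : 'rV[R[i]]_n), v *m complex_mx A = z *: v ->
      v *m map_mx (real_complex R) B = 0 -> v = 0.
    by move=> z v vA vB; apply: controllable_hautus ctrl vA vB.
  have [f [g fg]] := full_rank_matched pB (freeB i).
  exact: matched_submatrix fg.
- move=> sub i; have [J [K [cJ cK rk JX]]] := sub i.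
  have [f [g fg]] := submatrix_matched cJ cK rk JX.
  exact: (matched_paths (k := fun j => geo_mult A (lam j))) fg.
- move=> paths.
  have [i|B pB freeB] := common_full_rank (phi := real_complex R) (Bbar := Bbar)
      (Y := fun i => (X i)^T).
    have [P [pP dP sP]] := paths i; have [f [g fg]] := paths_matched pP dP sP.
    exists (matching_mx R f g); first exact: matching_mx_pattern fg.
    exact: matched_full_rank fg.
  exists B; split=> //; apply: hautus_controllable; exact/hautus.
Qed.
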